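(* Let $(A,\diamond,\ast,\alpha)$ be a Hom-pre-$F$-manifold algebra, and put $x\cdot y=x\diamond y+y\diamond x$ and $[x,y]=x\ast y-y\ast x$ for $x,y\in A$. Then: (i) $(A,\cdot,[\cdot,\cdot],\alpha)$ is a Hom-$F$-manifold algebra, called the sub-adjacent Hom-$F$-manifold algebra of $(A,\diamond,\ast,\alpha)$ and denoted $A^c$. (ii) $(A;L_\ast,L_\diamond,\alpha)$ is a representation of the sub-adjacent Hom-$F$-manifold algebra $A^c$, where $L_\ast(x)y=x\ast y$ and $L_\diamond(x)y=x\diamond y$.
   Context: All vector spaces are over an algebraically closed field $\mathbb K$ of characteristic $0$. In all structures below the twist map $\alpha:A\to A$ is a linear map. A Hom-Zinbiel algebra $(A,\diamond,\alpha)$: $\diamond$ is bilinear and $\alpha(x)\diamond(y\diamond z)=(y\diamond x)\diamond\alpha(z)+(x\diamond y)\diamond\alpha(z)$. A Hom-pre-Lie algebra $(A,\ast,\alpha)$: $\ast$ is bilinear and $(x\ast y)\ast\alpha(z)-\alpha(x)\ast(y\ast z)=(y\ast x)\ast\alpha(z)-\alpha(y)\ast(x\ast z)$. A Hom-pre-$F$-manifold algebra is a tuple $(A,\diamond,\ast,\alpha)$ such that $(A,\diamond,\alpha)$ is a Hom-Zinbiel algebra, $(A,\ast,\alpha)$ is a Hom-pre-Lie algebra, and for all $x,y,z,w\in A$ $$F_1(x\cdot y,\alpha(z),\alpha(w))=\alpha^2(x)\diamond F_1(y,z,w)+\alpha^2(y)\diamond F_1(x,z,w),$$ $$\mathcal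 L(x,y,z)\diamond\alpha^2(w)=F_2(\alpha(y),\alpha(z),x\diamond w)-\alpha^2(x)\diamond F_2(y,z,w),$$ where $x\cdot y=x\diamond y+y\diamond x$, $[x,y]=x\ast y-y\ast x$ and $$F_1(x,y,z)=\alpha(x)\ast(y\diamond z)-\alpha(y)\diamond(x\ast z)-[x,y]\diamond\alpha(z),$$ $$F_2(x,y,z)=\alpha(x)\diamond(y\ast z)+\alpha(y)\diamond(x\ast z)-(x\cdot y)\ast\alpha(z),$$ $$\mathcal L(x,y,z)=[\alpha(x),y\cdot z]-[x,y]\cdot\alpha(z)-\alpha(y)\cdot[x,z].$$ A Hom-$F$-manifold algebra is a tuple $(A,\cdot,[\cdot,\cdot],\alpha)$ such that: $\cdot$ is bilinear, commutative and $\alpha(x)\cdot(y\cdot z)=(x\cdot y)\cdot\alpha(z)$ (commutative Hom-associative algebra); $[\cdot,\cdot]$ is bilinear, skew-symmetric and $[\alpha(x),[y,z]]+[\alpha(y),[z,x]]+[\alpha(z),[x,y]]=0$ (Hom-Lie algebra); and $\mathcal L(x\cdot y,\alpha(z),\alpha(w))=\alpha^2(x)\cdot\mathcal L(y,z,w)+\alpha^2(y)\cdot\mathcal L(x,z,w)$ for all $x,y,z,w\in A$, with $\mathcal L$ given by the formula above. A representation of a Hom-$F$-manifold algebra $A$ is $(V;\rho,\mu,\phi)$ with $\rho,\mu:A\to\mathfrak{gl}(V)$ linear and $\phi\in\mathfrak{gl}(V)$ such that: $\mu(\alpha(x))\phi=\phi\mu(x)$, $\mu(x\cdot y)\phi=\mu(\alpha(x))\mu(y)$;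 $\rho(\alpha(x))\phi=\phi\rho(x)$, $\rho([x,y])\phi=\rho(\alpha(x))\rho(y)-\rho(\alpha(y))\rho(x)$; and for all $x,y,z\in A$, $u\in V$ $$\mathcal L_1(x\cdot y,\alpha(z),\phi(u))=\mu(\alpha^2(x))\mathcal L_1(y,z,u)+\mu(\alpha^2(y))\mathcal L_1(x,z,u),$$ $$\mu(\mathcal L(x,y,z))\phi^2(u)=\mathcal L_2(\alpha(y),\alpha(z),\mu(x)(u))-\mu(\alpha^2(x))\mathcal L_2(y,z,u),$$ where $\mathcal L_1(x,y,u)=\rho(\alpha(x))\mu(y)(u)-\mu(\alpha(y))\rho(x)(u)-\mu([x,y])\phi(u)$ and $\mathcal L_2(x,y,u)=\mu(\alpha(x))\rho(y)(u)+\mu(\alpha(y))\rho(x)(u)-\rho(x\cdot y)\phi(u)$.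
   Formalization: Part (ii) is proved assuming also that α(x◇y)=α(x)◇α(y) and α(x∗y)=α(x)∗α(y); without this (ii) fails, e.g. e1◇e1=e2 the only nonzero product, ∗=0, α=diag(1,2). *)

(* Defs.v *)
From HB Require Import structures.
From mathcomp Require Import all_boot all_order all_algebra.

Set Implicit Arguments.
Unset Strict Implicit.
Unset Printing Implicit Defensive.

Import GRing.Theory.
Local Open Scope ring_scope.

(* For f : A -> V -> V this says precisely that f is a linear map A -> gl(V):
   each f x is an endomorphism of V, and f x depends linearly on x. *)
Definition is_bilinear (K : fieldType) (U V W : lmodType K)
    (f : U -> V -> W) : Prop :=
  (forall x : U, linear (f x)) /\ (forall y : V, linear (fun x => f x y)).

Section Algebras.
Variables (K : fieldType) (A : lmodType K).
Implicit Types (dm st mul br op : A -> A -> A) (alpha : {linear A -> A}).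

Definition sub_mul dm (x y : A) : A := dm x y + dm y x.

Definition sub_bracket st (x y : A) : A := st x y - st y x.

Definition left_mult op (x : A) : A -> A := fun y => op x y.

(* Not among the axioms of a Hom-pre-F-manifold algebra, and not implied by
   them (take e1 <> e1 = e2 as only nonzero product, alpha = diag(1, 2)).  For
   (A; L_st, L_dm, alpha), the axioms rep_mu_twist and rep_rho_twist below say
   exactly that alpha is multiplicative for dm and for st. *)
Definition twist_multiplicative alpha op : Prop :=
  forall x y, alpha (op x y) = op (alpha x) (alpha y).

Definition leibnizator mul br alpha (x y z : A) : A :=
  br (alpha x) (mul y z) - mul (br x y) (alpha z) - mul (alpha y) (br x z).

Record hom_zinbiel dm alpha : Prop := HomZinbiel {
  zinbiel_bilinear : is_bilinear dm;
  zinbiel_identity : forall x y z,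
    dm (alpha x) (dm y z) = dm (dm y x) (alpha z) + dm (dm x y) (alpha z) }.

Record hom_pre_lie st alpha : Prop := HomPreLie {
  pre_lie_bilinear : is_bilinear st;
  pre_lie_identity : forall x y z,
    st (st x y) (alpha z) - st (alpha x) (st y z) =
    st (st y x) (alpha z) - st (alpha y) (st x z) }.

Definition F1 dm st alpha (x y z : A) : A :=
  st (alpha x) (dm y z) - dm (alpha y) (st x z)
  - dm (sub_bracket st x y) (alpha z).

Definition F2 dm st alpha (x y z : A) : A :=
  dm (alpha x) (st y z) + dm (alpha y) (st x z)
  - st (sub_mul dm x y) (alpha z).

Record hom_pre_F_manifold dm st alpha : Prop := HomPreFManifold {
  pre_F_zinbiel : hom_zinbiel dm alpha;
  pre_F_pre_lie : hom_pre_lie st alpha;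
  pre_F_identity1 : forall x y z w,
    F1 dm st alpha (sub_mul dm x y) (alpha z) (alpha w) =
    dm (alpha (alpha x)) (F1 dm st alpha y z w)
    + dm (alpha (alpha y)) (F1 dm st alpha x z w);
  pre_F_identity2 : forall x y z w,
    dm (leibnizator (sub_mul dm) (sub_bracket st) alpha x y z)
       (alpha (alpha w)) =
    F2 dm st alpha (alpha y) (alpha z) (dm x w)
    - dm (alpha (alpha x)) (F2 dm st alpha y z w) }.

Record comm_hom_assoc mul alpha : Prop := CommHomAssoc {
  hom_assoc_bilinear : is_bilinear mul;
  hom_assoc_comm : forall x y, mul x y = mul y x;
  hom_assoc_identity : forall x y z,
    mul (alpha x) (mul y z) = mul (mul x y) (alpha z) }.

Record hom_lie br alpha : Prop := HomLie {
  hom_lie_bilinear : is_bilinear br;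
  hom_lie_skew : forall x y, br x y = - br y x;
  hom_lie_jacobi : forall x y z,
    br (alpha x) (br y z) + br (alpha y) (br z x) + br (alpha z) (br x y)
    = 0 }.

Record hom_F_manifold mul br alpha : Prop := HomFManifold {
  F_manifold_assoc : comm_hom_assoc mul alpha;
  F_manifold_lie : hom_lie br alpha;
  F_manifold_identity : forall x y z w,
    leibnizator mul br alpha (mul x y) (alpha z) (alpha w) =
    mul (alpha (alpha x)) (leibnizator mul br alpha y z w)
    + mul (alpha (alpha y)) (leibnizator mul br alpha x z w) }.

End Algebras.

Section Representations.
Variables (K : fieldType) (A V : lmodType K).
Variables (mul br : A -> A -> A) (alpha : {linear A -> A}).
Variables (rho mu : A -> V -> V) (phi : {linear V -> V}).

Definition rep_L1 (x y : A) (u : V) : V :=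
  rho (alpha x) (mu y u) - mu (alpha y) (rho x u) - mu (br x y) (phi u).

Definition rep_L2 (x y : A) (u : V) : V :=
  mu (alpha x) (rho y u) + mu (alpha y) (rho x u) - rho (mul x y) (phi u).

Record hom_F_manifold_rep : Prop := HomFManifoldRep {
  rep_rho_linear : is_bilinear rho;
  rep_mu_linear : is_bilinear mu;
  rep_mu_twist : forall x u, mu (alpha x) (phi u) = phi (mu x u);
  rep_mu_mul : forall x y u, mu (mul x y) (phi u) = mu (alpha x) (mu y u);
  rep_rho_twist : forall x u, rho (alpha x) (phi u) = phi (rho x u);
  rep_rho_bracket : forall x y u,
    rho (br x y) (phi u) = rho (alpha x) (rho y u) - rho (alpha y) (rho x u);
  rep_identity1 : forall x y z u,
    rep_L1 (mul x y) (alpha z) (phi u) =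
    mu (alpha (alpha x)) (rep_L1 y z u) + mu (alpha (alpha y)) (rep_L1 x z u);
  rep_identity2 : forall x y z u,
    mu (leibnizator mul br alpha x y z) (phi (phi u)) =
    rep_L2 (alpha y) (alpha z) (mu x u)
    - mu (alpha (alpha x)) (rep_L2 y z u) }.

End Representations.

(* Main.v *)
Require Import Defs.
From HB Require Import structures.
From mathcomp Require Import all_boot all_order all_algebra.
Import GRing.Theory.
Local Open Scope ring_scope.

(** The leibnizator of the symmetrized product and commutator bracket splits as
    [L(x,y,z) = F1(x,y,z) + F1(x,z,y) + F2(y,z,x)].  Applying the two
    compatibility identities to the three summands of [L(x.y, az, aw)], the F1
    and F2 terms recombine into the left products [a^2 x <> L(y,z,w)] while the
    second identity supplies the right products [L(x,z,w) <> a^2 y].  The axioms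
    of a representation are then those of the pre-F-manifold algebra itself. *)

Ltac raise_summand y := repeat progress rewrite [_ + (y + _)]addrCA.

(* Decides linear identities between summands in an abelian group: both sides
   are gathered into a right-nested sum ending in 0, and each leading term is
   cancelled with its opposite, which is first bubbled up to the front. *)
Ltac zmod_identity :=
  apply/eqP; rewrite -subr_eq0; apply/eqP;
  rewrite !(opprD, opprK, oppr0, addr0) -[LHS]addr0 -?addrA;
  repeat match goal with
  | |- - ?y + _ = 0 => raise_summand y; rewrite addNKr
  | |- ?y + _ = 0 => raise_summand (- y); rewrite addKr
  end; reflexivity.

Section Bilinear.
Set Implicit Arguments.
Variables (K : fieldType) (U V W : lmodType K) (f : U -> V -> W).
Hypothesis f_bilin : is_bilinear f.

Lemma bilinearDr x y z : f x (y + z) = f x y + f x z.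
Proof. by have := f_bilin.1 x 1 y z; rewrite !scale1r. Qed.

Lemma bilinearDl x y z : f (x + y) z = f x z + f y z.
Proof. by have := f_bilin.2 z 1 x y; rewrite !scale1r. Qed.

Lemma bilinearBr x y z : f x (y - z) = f x y - f x z.
Proof. by have := f_bilin.1 x (-1) z y; rewrite !scaleN1r ![- _ + _]addrC. Qed.

Lemma bilinearBl x y z : f (x - y) z = f x z - f y z.
Proof. by have := f_bilin.2 z (-1) y x; rewrite !scaleN1r ![- _ + _]addrC. Qed.

End Bilinear.

Section SubAdjacent.
Set Implicit Arguments.
Variables (K : fieldType) (A : lmodType K).
Implicit Types (dm st : A -> A -> A) (alpha : {linear A -> A}).

Lemma sub_mulC dm x y : sub_mul dm x y = sub_mul dm y x.
Proof. exact: addrC. Qed.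

Lemma sub_bracketN st x y : sub_bracket st x y = - sub_bracket st y x.
Proof. by rewrite /sub_bracket opprB. Qed.

Lemma sub_mul_bilinear dm : is_bilinear dm -> is_bilinear (sub_mul dm).
Proof.
by case=> linr linl; split=> x a y z;
  rewrite /sub_mul linr linl scalerDr addrACA.
Qed.

Lemma sub_bracket_bilinear st : is_bilinear st -> is_bilinear (sub_bracket st).
Proof.
by case=> linr linl; split=> x a y z;
  rewrite /sub_bracket linr linl scalerBr opprD addrACA.
Qed.

(** The Hom-Zinbiel identity, with its two right-hand terms merged by bilinearity. It serves both
    for associativity and as the axiom [rep_mu_mul]. *)
Lemma zinbiel_mulA dm alpha (hZ : hom_zinbiel dm alpha) x y z :
  dm (sub_mul dm x y) (alpha z) = dm (alpha x) (dm y z).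
Proof.
rewrite (zinbiel_identity hZ) /sub_mul (bilinearDl (zinbiel_bilinear hZ)).
exact: addrC.
Qed.

Lemma pre_lie_bracketA st alpha (hP : hom_pre_lie st alpha) x y z :
  st (sub_bracket st x y) (alpha z)
  = st (alpha x) (st y z) - st (alpha y) (st x z).
Proof.
rewrite /sub_bracket (bilinearBl (pre_lie_bilinear hP)).
have /eqP := pre_lie_identity hP x y z; rewrite subr_eq => /eqP ->.
zmod_identity.
Qed.

Lemma zinbiel_comm_hom_assoc dm alpha :
  hom_zinbiel dm alpha -> comm_hom_assoc (sub_mul dm) alpha.
Proof.
move=> hZ; have dmDr := bilinearDr (zinbiel_bilinear hZ).
(* As [sub_mul dm] commutes, this expansion is symmetric in [x], [y], [z], which yields
   associativity. *)
have mulE x y z : sub_mul dm (alpha x) (sub_mul dm y z) =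
    dm (sub_mul dm x y) (alpha z) + dm (sub_mul dm x z) (alpha y)
    + dm (sub_mul dm y z) (alpha x).
  by rewrite {1}/sub_mul {1}/sub_mul dmDr -!(zinbiel_mulA hZ).
split=> [|x y|x y z]; [exact/sub_mul_bilinear/zinbiel_bilinear/hZ
  | exact: sub_mulC |].
rewrite [RHS]sub_mulC !mulE (sub_mulC dm z x) (sub_mulC dm z y).
zmod_identity.
Qed.

Lemma pre_lie_hom_lie st alpha :
  hom_pre_lie st alpha -> hom_lie (sub_bracket st) alpha.
Proof.
move=> hP; have stBr := bilinearBr (pre_lie_bilinear hP).
split=> [|x y|x y z]; [exact/sub_bracket_bilinear/pre_lie_bilinear/hP
  | exact: sub_bracketN |].
(* Every term now has the form [st (alpha a) (st b c)]; in the cyclic sum each of the six orderings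
   occurs twice, with opposite signs. *)
have brE u v w : sub_bracket st (alpha u) (sub_bracket st v w) =
    st (alpha u) (st v w) - st (alpha u) (st w v)
    - (st (alpha v) (st w u) - st (alpha w) (st v u)).
  by rewrite {1}/sub_bracket pre_lie_bracketA // {1}/sub_bracket stBr.
rewrite !brE; zmod_identity.
Qed.

(** [F2] brings [- st (sub_mul dm y z) (alpha x)] and the halves [st z x], [st y x] of the
    commutators that the two [F1] terms leave incomplete. *)
Lemma leibnizatorE dm st alpha x y z :
  is_bilinear dm -> is_bilinear st ->
  leibnizator (sub_mul dm) (sub_bracket st) alpha x y z =
  F1 dm st alpha x y z + F1 dm st alpha x z y + F2 dm st alpha y z x.
Proof.
move=> hdm hst; rewrite /leibnizator /F1 /F2 /sub_mul /sub_bracket.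
rewrite !(bilinearBl hdm, bilinearBr hdm, bilinearDl hdm).
rewrite !(bilinearDl hst, bilinearDr hst).
zmod_identity.
Qed.

Lemma F2Dr dm st alpha x y z w :
  is_bilinear dm -> is_bilinear st ->
  F2 dm st alpha x y (z + w) = F2 dm st alpha x y z + F2 dm st alpha x y w.
Proof.
move=> hdm hst; rewrite /F2 raddfD !(bilinearDr hst) !(bilinearDr hdm).
zmod_identity.
Qed.

Lemma sub_adjacent_hom_F_manifold dm st alpha :
  hom_pre_F_manifold dm st alpha ->
  hom_F_manifold (sub_mul dm) (sub_bracket st) alpha.
Proof.
case=> hZ hP id1 id2.
have hdm := zinbiel_bilinear hZ; have hst := pre_lie_bilinear hP.
split; [exact: zinbiel_comm_hom_assoc | exact: pre_lie_hom_lie |].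
move=> x y z w; set L := leibnizator _ _ _.
have LE a b c : L a b c = F1 dm st alpha a b c + F1 dm st alpha a c b
    + F2 dm st alpha b c a by exact: leibnizatorE.
have F2E a b : F2 dm st alpha (alpha z) (alpha w) (dm a b) =
    dm (L a z w) (alpha (alpha b)) + dm (alpha (alpha a)) (F2 dm st alpha z w b).
  by rewrite id2 subrK.
(* [id1] rewrites both [F1] terms, which differ by swapping [z] and [w]; [F2E] then applies to each
   half of the product of [x] and [y]. *)
rewrite LE !id1 [X in F2 _ _ _ _ _ X]/sub_mul F2Dr // !F2E.
have dmLE a b : dm a (L b z w) = dm a (F1 dm st alpha b z w)
    + dm a (F1 dm st alpha b w z) + dm a (F2 dm st alpha z w b).
  by rewrite LE !(bilinearDr hdm).
rewrite /sub_mul !dmLE.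
zmod_identity.
Qed.

Lemma left_mult_hom_F_manifold_rep dm st alpha :
  hom_pre_F_manifold dm st alpha ->
  twist_multiplicative alpha dm -> twist_multiplicative alpha st ->
  hom_F_manifold_rep (sub_mul dm) (sub_bracket st) alpha
    (left_mult st) (left_mult dm) alpha.
Proof.
case=> hZ hP id1 id2 dm_twist st_twist; split.
- exact: pre_lie_bilinear hP.
- exact: zinbiel_bilinear hZ.
- by move=> x u; rewrite /left_mult dm_twist.
- exact: zinbiel_mulA.
- by move=> x u; rewrite /left_mult st_twist.
- exact: pre_lie_bracketA.
(* At left multiplications with [phi] equal to [alpha], [rep_L1] and [rep_L2] are convertible to
   [F1] and [F2]. *)
- exact: id1.
- exact: id2.
Qed.

End SubAdjacent.

Theorem theorem4p13 (K : closedFieldType) (hK : [pchar K] =i pred0)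
    (A : lmodType K) (dm st : A -> A -> A) (alpha : {linear A -> A})
    (hA : hom_pre_F_manifold dm st alpha) :
  hom_F_manifold (sub_mul dm) (sub_bracket st) alpha /\
  (twist_multiplicative alpha dm -> twist_multiplicative alpha st ->
   hom_F_manifold_rep (sub_mul dm) (sub_bracket st) alpha
     (left_mult st) (left_mult dm) alpha).
Proof.
split; first exact: sub_adjacent_hom_F_manifold.
exact: left_mult_hom_F_manifold_rep.
Qed.
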